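(* Consider the nonautonomous discrete Gray–Scott system described in the context, suppose that its data satisfy assumptions (H1) and (H2) listed there, and let $\{U_\sigma(t,0)\}_{t\ge0}$, $\sigma\in\mathbb T^\kappa$, be the family of processes it generates in $E=\ell^2\times\ell^2\times\ell^2$. Then for any $\varepsilon>0$ there exists a family of sets $\{\mathcal A_\varepsilon(\sigma)\}_{\sigma\in\mathbb T^\kappa}$ in $E$ with $$A(\sigma)\subset\mathcal A_\varepsilon(\sigma)\subset\mathcal N_\varepsilon(\sigma)\qquad\text{for all }\sigma\in\mathbb T^\kappa,$$ which is forward invariant for $\{U_\sigma(t,0)\}_{t\ge0}$, $\sigma\in\mathbb T^\kappa$. Here $\{A(\sigma)\}_{\sigma\in\mathbb T^\kappa}$ is the pullback attractor of the family of processes and $\mathcal N_\varepsilon(\sigma)$ is the $\sigma$-section of the $\varepsilon$-neighborhood of $\bigcup_{\sigma\in\mathbb T^\kappa}(A(\sigma)\times\{\sigma\})$ in $E\times\mathbb T^\kappa$. Moreover, $\{\mathcal A_\varepsilon(\sigma)\}_{\sigma\in\mathbb T^\kappa}$ uniformly (w.r.t. $\sigma\in\mathbb T^\kappa$) forward attracts each bounded set $B\subset E$: $$\lim_{t\to+\infty}\ \sup_{\sigma\in\mathbb T^\kappa}\mathrm d_H\big(U_\sigma(t,0)B,\mathcal A_\varepsilon(\theta_t\sigma)\big)=0 .$$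
   Context: $\ell^2=\{u=(u_m)_{m\in\mathbb Z}:u_m\in\mathbb R,\ \sum_m u_m^2<\infty\}$ and $E=\ell^2\times\ell^2\times\ell^2$ with the product Hilbert norm. Products of sequences are componentwise: $u^2v=(u_m^2v_m)_m$, $u^3=(u_m^3)_m$. The operator $A$ on $\ell^2$ is $(Au)_m=2u_m-u_{m+1}-u_{m-1}$. For $X,Y\subset E$, $\mathrm d_H(X,Y)=\sup_{x\in X}\inf_{y\in Y}\|x-y\|$. Torus and symbols: $\mathbb T^\kappa$ is the $\kappa$-dimensional torus $[-\pi,\pi]^\kappa$ with opposite faces identified ($\sigma_i=-\pi\sim\sigma_i=\pi$), with the metric induced from $\mathbb R^\kappa$; $\|\sigma\|_{\mathbb T^\kappa}=(\sum_{i=1}^\kappa\sigma_i^2)^{1/2}$. Fix $\mathbf x=(x_1,\dots,x_\kappa)\in\mathbb R^\kappa$ with rationally independent components, and set $\theta_s\sigma=(\mathbf xs+\sigma)\bmod\mathbb T^\kappa$, $s\in\mathbb R$. For a given $\sigma\in\mathbb T^\kappa$, $\sigma(t)=\theta_t\sigma$. The space $E\times\mathbb T^\kappa$ carries the metric coming from $\|(\varphi,\sigma)\|=(\|\varphi\|^2+\|\sigma\|_{\mathbb T^\kappa}^2)^{1/2}$. Gray–Scott system: $d_1,d_2,d_3,k,\alpha,\beta,\lambda>0$ are constants, $a=(a_m)$, $b_i=(b_{im})$ are real sequences, $f_{im}:\mathbb T^\kappa\to\mathbb R$ ($i=1,2,3$, $m\in\mathbb Z$), $b_if_i(\sigma(t))=(b_{im}f_{im}(\sigma(t)))_m$,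 and $$\dot u=-d_1Au-(\lambda+k)u+u^2v-\alpha u^3+\beta z+b_1f_1(\sigma(t)),$$ $$\dot v=-d_2Av-\lambda v-u^2v+\alpha u^3+\lambda a+b_2f_2(\sigma(t)),$$ $$\dot z=-d_3Az+ku-(\lambda+\beta)z+b_3f_3(\sigma(t)),$$ with initial condition $\varphi(t_0)=(u(t_0),v(t_0),z(t_0))=\varphi_0\in E$. Assumptions. (H1): $a\in\ell^2$, $b_i\in\ell^2$ ($i=1,2,3$), and $2\beta<k<\min\{\frac{3\lambda}{2\mu-1},\beta+\lambda\}$, where $\mu=k/\beta$. (H2): $f_{im}(0_{\mathbb T^\kappa})=0$ for all $m\in\mathbb Z$, $i=1,2,3$, and there exist $c_1,c_2,c_3>0$ with $|f_{im}(\sigma_{01})-f_{im}(\sigma_{02})|\le c_i\|\sigma_{01}-\sigma_{02}\|_{\mathbb T^\kappa}$ for all $m\in\mathbb Z$, $\sigma_{01},\sigma_{02}\in\mathbb T^\kappa$, $i=1,2,3$. Under (H1)–(H2) the system has, for all $\varphi_0\in E$, $t_0\in\mathbb R$, $\sigma\in\mathbb T^\kappa$, a unique global solution $\varphi(t,t_0;\varphi_0,\sigma)$, $t\ge t_0$, continuous in $E$; set $U_\sigma(t,0)\varphi_0=\varphi(t,0;\varphi_0,\sigma)$, $t\ge0$. The skew-product flow is the semigroup $\Psi(t)(\varphi,\sigma)=(U_\sigma(t,0)\varphi,\theta_t\sigma)$ on $E\times\mathbb T^\kappa$. It has a global attractor (compact, invariant, attracting bounded sets) of the form $\bigcup_{\sigma\in\mathbb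 T^\kappa}(A(\sigma)\times\{\sigma\})$, and its $\sigma$-sections $\{A(\sigma)\}_{\sigma\in\mathbb T^\kappa}$ form the pullback attractor. The $\sigma$-section of $S\subset E\times\mathbb T^\kappa$ is $\{\varphi\in E:(\varphi,\sigma)\in S\}$; the $\varepsilon$-neighborhood of a set is the set of points at distance $<\varepsilon$ from it. A family $\{\mathcal C(\sigma)\}_{\sigma\in\mathbb T^\kappa}$ of subsets of $E$ is forward invariant if $U_\sigma(t,0)\mathcal C(\sigma)\subset\mathcal C(\theta_t\sigma)$ for all $t\ge0$, $\sigma\in\mathbb T^\kappa$. *)

(* Defs.v *)
(* The discrete Gray-Scott system driven by a quasi-periodic flow on the torus,
   over an arbitrary [R : realType], in MathComp-Analysis. *)
From HB Require Import structures.
From mathcomp Require Import all_boot all_order all_algebra.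
From mathcomp Require Import all_classical all_reals all_analysis.
From mathcomp Require Import ring lra.

Set Implicit Arguments.
Unset Strict Implicit.
Unset Printing Implicit Defensive.

Import Order.TTheory GRing.Theory Num.Theory.
Import numFieldNormedType.Exports.

Local Open Scope classical_set_scope.
Local Open Scope ring_scope.

Section euclidean_triangle.
Variable R : realType.

Lemma sqrD_le (t a b : R) : 0 < t ->
  (a + b) ^+ 2 <= (1 + t) * a ^+ 2 + (1 + t^-1) * b ^+ 2.
Proof.
move=> t0; rewrite -subr_ge0.
have -> : (1 + t) * a ^+ 2 + (1 + t^-1) * b ^+ 2 - (a + b) ^+ 2
    = t^-1 * (t * a - b) ^+ 2 by field; rewrite gt_eqF.
by rewrite mulr_ge0 ?sqr_ge0 // invr_ge0 ltW.
Qed.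

Lemma le_of_scaled (r Z : R) : (forall t, 0 < t -> Z <= (1 + t^-1) * r) ->
  0 <= r -> Z <= r.
Proof.
move=> h r0; rewrite leNgt; apply/negP => rZ.
have [r00|rp] := eqVneq r 0.
  by have := h 1 ltr01; rewrite r00 mulr0 -r00 leNgt rZ.
have rp' : 0 < r by rewrite lt_neqAle eq_sym rp.
have d0 : 0 < Z - r by rewrite subr_gt0.
have := h (2 * r / (Z - r)) _; rewrite divr_gt0 ?mulr_gt0 // => /(_ isT).
have -> : (1 + (2 * r / (Z - r))^-1) * r = r + (Z - r) / 2.
  by field; rewrite !gt_eqF.
lra.
Qed.

Lemma sqrt_triangle (X Y Z : R) : 0 <= X -> 0 <= Y ->
  (forall t, 0 < t -> Z <= (1 + t) * X + (1 + t^-1) * Y) ->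
  Num.sqrt Z <= Num.sqrt X + Num.sqrt Y.
Proof.
move=> X0 Y0 h.
have s0 := sqrtr_ge0 X; have r0 := sqrtr_ge0 Y.
suff H : Z <= (Num.sqrt X + Num.sqrt Y) ^+ 2.
  rewrite (le_trans (ler_wsqrtr H)) // sqrtr_sqr ger0_norm // addr_ge0 //.
have [Xz|Xn] := eqVneq X 0.
  rewrite Xz sqrtr0 add0r sqr_sqrtr //; apply: le_of_scaled => // t t0.
  by have := h t t0; rewrite Xz mulr0 add0r.
have [Yz|Yn] := eqVneq Y 0.
  rewrite Yz sqrtr0 addr0 sqr_sqrtr //; apply: le_of_scaled => // t t0.
  by have := h t^-1; rewrite invr_gt0 Yz mulr0 addr0; apply.
have sp : 0 < Num.sqrt X by rewrite sqrtr_gt0 lt_neqAle eq_sym Xn.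
have rp : 0 < Num.sqrt Y by rewrite sqrtr_gt0 lt_neqAle eq_sym Yn.
have := h _ (divr_gt0 rp sp).
rewrite -{2}(sqr_sqrtr X0) -{3}(sqr_sqrtr Y0).
set s := Num.sqrt X in sp *; set r := Num.sqrt Y in rp *.
have -> // : (1 + r / s) * s ^+ 2 + (1 + (r / s)^-1) * r ^+ 2 = (s + r) ^+ 2.
by field; rewrite !gt_eqF.
Qed.

Lemma sqrt_sqrD (a b a' b' c c' : R) :
  0 <= a -> 0 <= b -> a <= a' + c -> b <= b' + c' ->
  Num.sqrt (a ^+ 2 + b ^+ 2)
    <= Num.sqrt (a' ^+ 2 + b' ^+ 2) + Num.sqrt (c ^+ 2 + c' ^+ 2).
Proof.
move=> a0 b0 ha hb.
apply: sqrt_triangle; rewrite ?addr_ge0 ?sqr_ge0 // => t t0.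
have h1 : a ^+ 2 <= (a' + c) ^+ 2 by rewrite ler_sqr ?nnegrE // (le_trans a0).
have h2 : b ^+ 2 <= (b' + c') ^+ 2 by rewrite ler_sqr ?nnegrE // (le_trans b0).
have h3 := sqrD_le a' c t0.
have h4 := sqrD_le b' c' t0.
lra.
Qed.

End euclidean_triangle.

(* Bi-infinite real sequences are functions [int -> R]. *)
Section l2_def.
Variable R : realType.
Implicit Types u v : int -> R.

Definition sumsq u : \bar R := \esum_(m in [set: int]) (u m ^+ 2)%:E.

Definition l2_pred : {pred int -> R} := mem [set u | (sumsq u < +oo)%E].

Lemma sumsq_ge0 u : (0 <= sumsq u)%E.
Proof. by apply: esum_ge0 => m _; rewrite lee_fin sqr_ge0. Qed.

Lemma sumsqZ_le (c : R) u :
  (\esum_(m in [set: int]) (c ^+ 2 * u m ^+ 2)%:E <= (c ^+ 2)%:E * sumsq u)%E.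
Proof.
apply: ge_ereal_sup => _ [X [finX _] <-].
rewrite (eq_fsbigr (fun m => ((c ^+ 2)%:E * (u m ^+ 2)%:E)%E)) => [|m _];
  last by rewrite EFinM.
rewrite -ge0_mule_fsumr; last by move=> m; rewrite lee_fin sqr_ge0.
apply: lee_wpmul2l; first by rewrite lee_fin sqr_ge0.
by apply: ereal_sup_ubound; exists X.
Qed.

Lemma sumsqD_le (t : R) u v : 0 < t ->
  (sumsq (u + v)%R <= (1 + t)%R%:E * sumsq u + (1 + t^-1)%R%:E * sumsq v)%E.
Proof.
move=> t0.
have t1 : 0 <= 1 + t by rewrite addr_ge0 // ltW.
have t2 : 0 <= 1 + t^-1 by rewrite addr_ge0 // invr_ge0 ltW.
pose c := Num.sqrt (1 + t); pose d := Num.sqrt (1 + t^-1).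
have cE : c ^+ 2 = 1 + t by rewrite sqr_sqrtr.
have dE : d ^+ 2 = 1 + t^-1 by rewrite sqr_sqrtr.
rewrite -cE -dE.
apply: le_trans (leeD (sumsqZ_le c u) (sumsqZ_le d v)).
rewrite -esumD; [|by move=> m _; rewrite lee_fin mulr_ge0 ?sqr_ge0..].
apply: le_esum => m _; rewrite -EFinD lee_fin cE dE.
exact: sqrD_le.
Qed.

Lemma sumsqZ_le' (c : R) u : (sumsq (c *: u)%R <= (c ^+ 2)%:E * sumsq u)%E.
Proof.
apply: le_trans (sumsqZ_le c u); apply: le_esum => m _.
by rewrite lee_fin -exprMn.
Qed.

Lemma l2_submod_closed : submod_closed l2_pred.
Proof.
have finM (c : R) (x : \bar R) : 0 <= c -> (x < +oo)%E -> (c%:E * x < +oo)%E.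
  by move=> c0 xoo; rewrite lte_mul_pinfty ?lee_fin.
split.
  by rewrite inE /= /sumsq esum1 // => m _; rewrite expr0n.
move=> c u v; rewrite !inE /= => hu hv.
apply: le_lt_trans (sumsqD_le _ _ ltr01) _.
apply: lte_add_pinfty; apply: (finM) => //.
  by apply: le_lt_trans (sumsqZ_le' c u) _; apply: (finM); rewrite ?sqr_ge0.
Qed.

HB.instance Definition _ :=
  GRing.isSubmodClosed.Build _ _ l2_pred l2_submod_closed.

Definition l2 : Type := {u : int -> R | u \in l2_pred}.

HB.instance Definition _ := SubChoice.copy l2 {u : int -> R | u \in l2_pred}.
HB.instance Definition _ := [SubChoice_isSubLmodule of l2 by <:].

Definition l2norm (u : l2) : R := Num.sqrt (fine (sumsq (val u))).

Lemma l2_fin_num (u : l2) : sumsq (val u) \is a fin_num.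
Proof. by rewrite ge0_fin_numE ?sumsq_ge0 //; have := valP u; rewrite inE. Qed.

Lemma fine_sumsq_ge0 u : 0 <= fine (sumsq u).
Proof. by rewrite fine_ge0 // sumsq_ge0. Qed.

Lemma l2normD (u v : l2) : l2norm (u + v) <= l2norm u + l2norm v.
Proof.
apply: sqrt_triangle; rewrite ?fine_sumsq_ge0 // => t t0.
rewrite -lee_fin EFinD !EFinM !fineK ?l2_fin_num //.
by rewrite (_ : val (u + v) = val u + val v) ?sumsqD_le.
Qed.

Lemma l2normZ_le (c : R) (u : l2) : l2norm (c *: u) <= `|c| * l2norm u.
Proof.
rewrite -sqrtr_sqr -sqrtrM ?sqr_ge0 //; apply: ler_wsqrtr.
rewrite -lee_fin EFinM !fineK ?l2_fin_num //.
exact: sumsqZ_le'.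
Qed.

Lemma l2normZ (c : R) (u : l2) : l2norm (c *: u) = `|c| * l2norm u.
Proof.
apply/eqP; rewrite eq_le l2normZ_le /=.
have [->|c0] := eqVneq c 0; first by rewrite normr0 mul0r sqrtr_ge0.
have := l2normZ_le c^-1 (c *: u); rewrite scalerA mulVf // scale1r.
by rewrite normfV mulrC ler_pdivlMr ?normr_gt0 // mulrC.
Qed.

Lemma l2norm0_eq0 (u : l2) : l2norm u = 0 -> u = 0.
Proof.
move=> /eqP; rewrite sqrtr_eq0 => u0; apply/val_inj/funext => m /=.
have : ((val u m ^+ 2)%:E <= 0)%E.
  have <- : sumsq (val u) = 0%E.
    rewrite -(fineK (l2_fin_num u)); congr EFin; apply/eqP.
    by rewrite eq_le u0 fine_sumsq_ge0.
  apply: esum_ge; exists [set m]; first by split.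
  by rewrite fsbig_set1.
rewrite lee_fin => h; apply/eqP; rewrite -sqrf_eq0 eq_le h sqr_ge0 //.
Qed.

HB.instance Definition _ :=
  Lmodule_isNormed.Build R l2 l2normD l2normZ l2norm0_eq0.

End l2_def.

Definition l2_fun (R : realType) (u : l2 R) : int -> R := val u.
Coercion l2_fun : l2 >-> Funclass.

(* E = l2 x l2 x l2. A record rather than an iterated pair, so that the Hilbert
   norm does not compete with the sup norm that the library puts on pairs. *)
Record E3 (R : realType) := MkE3 { ucomp : l2 R; vcomp : l2 R; zcomp : l2 R }.

Section E3_normed.
Variable R : realType.
Implicit Types p q : E3 R.

HB.instance Definition _ := gen_eqMixin (E3 R).
HB.instance Definition _ := gen_choiceMixin (E3 R).

Lemma E3_ext p q : ucomp p = ucomp q -> vcomp p = vcomp q ->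
  zcomp p = zcomp q -> p = q.
Proof. by case: p q => [? ? ?] [? ? ?] /= -> -> ->. Qed.

Definition E3_zero : E3 R := MkE3 0 0 0.
Definition E3_opp p := MkE3 (- ucomp p) (- vcomp p) (- zcomp p).
Definition E3_add p q :=
  MkE3 (ucomp p + ucomp q) (vcomp p + vcomp q) (zcomp p + zcomp q).
Definition E3_scale (c : R) p :=
  MkE3 (c *: ucomp p) (c *: vcomp p) (c *: zcomp p).

Lemma E3_addA : associative E3_add.
Proof. by move=> p q r; apply: E3_ext; rewrite /= addrA. Qed.
Lemma E3_addC : commutative E3_add.
Proof. by move=> p q; apply: E3_ext; rewrite /= addrC. Qed.
Lemma E3_add0 : left_id E3_zero E3_add.
Proof. by move=> p; apply: E3_ext; rewrite /= add0r. Qed.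
Lemma E3_addN : left_inverse E3_zero E3_opp E3_add.
Proof. by move=> p; apply: E3_ext; rewrite /= addNr. Qed.

HB.instance Definition _ :=
  GRing.isZmodule.Build (E3 R) E3_addA E3_addC E3_add0 E3_addN.

Lemma E3_scaleA a b p : E3_scale a (E3_scale b p) = E3_scale (a * b) p.
Proof. by apply: E3_ext; rewrite /= scalerA. Qed.
Lemma E3_scale1 : left_id 1 E3_scale.
Proof. by move=> p; apply: E3_ext; rewrite /= scale1r. Qed.
Lemma E3_scaleDr : right_distributive E3_scale +%R.
Proof. by move=> a p q; apply: E3_ext; rewrite /= scalerDr. Qed.
Lemma E3_scaleDl p : {morph E3_scale^~ p : a b / a + b}.
Proof. by move=> a b; apply: E3_ext; rewrite /= scalerDl. Qed.

HB.instance Definition _ := GRing.Zmodule_isLmodule.Build R (E3 R)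
  E3_scaleA E3_scale1 E3_scaleDr E3_scaleDl.

Definition E3_norm p : R :=
  Num.sqrt (`|ucomp p| ^+ 2 + `|vcomp p| ^+ 2 + `|zcomp p| ^+ 2).

Lemma E3_normD p q : E3_norm (p + q) <= E3_norm p + E3_norm q.
Proof.
have nest (a b : R) : a ^+ 2 + b ^+ 2 = Num.sqrt (a ^+ 2 + b ^+ 2) ^+ 2.
  by rewrite sqr_sqrtr // addr_ge0 ?sqr_ge0.
rewrite /E3_norm (nest `|ucomp (p + q)|) (nest `|ucomp p|) (nest `|ucomp q|).
apply: sqrt_sqrD; rewrite ?sqrtr_ge0 ?normr_ge0 ?ler_normD //.
by apply: sqrt_sqrD; rewrite ?normr_ge0 ?ler_normD.
Qed.

Lemma E3_normZ (c : R) p : E3_norm (c *: p) = `|c| * E3_norm p.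
Proof.
rewrite /E3_norm /= !normrZ !exprMn -!mulrDr sqrtrM ?sqr_ge0 //.
by rewrite sqrtr_sqr normr_id.
Qed.

Lemma E3_norm0_eq0 p : E3_norm p = 0 -> p = 0.
Proof.
move=> /eqP; rewrite sqrtr_eq0 => h.
have hu := sqr_ge0 `|ucomp p|; have hv := sqr_ge0 `|vcomp p|.
have hz := sqr_ge0 `|zcomp p|.
apply: E3_ext => /=; apply/eqP; rewrite -normr_eq0 -sqrf_eq0; apply/eqP; lra.
Qed.

HB.instance Definition _ :=
  Lmodule_isNormed.Build R (E3 R) E3_normD E3_normZ E3_norm0_eq0.

End E3_normed.

(* The torus [-pi, pi]^kappa with opposite faces identified: each class is
   represented by its unique point of [-pi, pi[^kappa. *)
Section torus.
Variables (R : realType) (kappa : nat).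

Definition mod2pi (x : R) : R :=
  x - 2 * pi * (Num.floor ((x + pi) / (2 * pi)))%:~R.

Lemma mod2pi_itv x : - pi <= mod2pi x < pi.
Proof.
have p0 : 0 < 2 * pi :> R by rewrite mulr_gt0 // pi_gt0.
have /andP[] := floor_itv ((x + pi) / (2 * pi)).
rewrite intrD ler_pdivlMr // ltr_pdivrMr // /mod2pi.
set n := (_ %:~R) => h1 h2; apply/andP; split; lra.
Qed.

Definition torus : Type :=
  {s : 'rV[R]_kappa | [forall i, - pi <= s ord0 i < pi]}.

HB.instance Definition _ := SubChoice.copy torus
  {s : 'rV[R]_kappa | [forall i, - pi <= s ord0 i < pi]}.

Lemma torus_proj_subproof (s : 'rV[R]_kappa) :
  [forall i, - pi <= map_mx mod2pi s ord0 i < pi].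
Proof. by apply/forallP => i; rewrite mxE mod2pi_itv. Qed.

Definition torus_proj (s : 'rV[R]_kappa) : torus :=
  exist _ (map_mx mod2pi s) (torus_proj_subproof s).

Definition torus_norm (s : torus) : R :=
  Num.sqrt (\sum_(i < kappa) val s ord0 i ^+ 2).

(* Quotient metric: the difference is taken in the torus, that is, modulo
   2 pi, before its norm is measured. *)
Definition torus_dist (s t : torus) : R :=
  torus_norm (torus_proj (val s - val t)).

Lemma mod2pi_min (x : R) (n : int) : `|mod2pi x| <= `|x + 2 * pi * n%:~R|.
Proof.
have pp : 0 < pi :> R := pi_gt0 R.
have /andP[h1 h2] := mod2pi_itv x.
pose m := Num.floor ((x + pi) / (2 * pi)).
have -> : x + 2 * pi * n%:~R = mod2pi x + 2 * pi * (n + m)%:~R.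
  by rewrite /mod2pi -/m intrD; ring.
have hm : `|mod2pi x| <= pi by rewrite ler_norml h1 ltW.
have [-> | nm0] := eqVneq (n + m) 0; first by rewrite mulr0 addr0.
have H : 1 <= `|(n + m)%:~R| :> R.
  by rewrite -intr_norm -[1]/(1%:~R) ler_int -gtz0_ge1 normr_gt0.
have := lerB_normD (2 * pi * (n + m)%:~R) (mod2pi x).
have p2 : 0 <= 2 * pi :> R by rewrite mulr_ge0 // ltW.
rewrite [_ + mod2pi x]addrC normrM (ger0_norm p2).
apply: le_trans; nra.
Qed.

Lemma mod2piE (x : R) : exists n : int, mod2pi x = x + 2 * pi * n%:~R.
Proof. by eexists (- _); rewrite intrN mulrN. Qed.

Lemma mod2piN (x : R) : `|mod2pi (- x)| = `|mod2pi x|.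
Proof.
wlog suff H : x / `|mod2pi (- x)| <= `|mod2pi x|.
  by apply/eqP; rewrite eq_le H /= -{1}(opprK x) H.
have [n ->] := mod2piE x.
by rewrite -[leRHS]normrN opprD -mulrN -intrN mod2pi_min.
Qed.

Lemma mod2piD (x y : R) : `|mod2pi (x + y)| <= `|mod2pi x| + `|mod2pi y|.
Proof.
have [n ex] := mod2piE x; have [m ey] := mod2piE y.
apply: le_trans (mod2pi_min (x + y) (n + m)) _.
apply: le_trans _ (ler_normD _ _); rewrite ex ey intrD.
by rewrite mulrDr addrACA.
Qed.

Lemma torus_distxx s : torus_dist s s = 0.
Proof.
rewrite /torus_dist /torus_norm /= big1 ?sqrtr0 // => i _.
have := mod2pi_min 0 0; rewrite !mxE subrr mulr0 addr0 normr0 normr_le0.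
by move=> /eqP ->; rewrite expr0n.
Qed.

Lemma torus_dist_sym s t : torus_dist s t = torus_dist t s.
Proof.
congr Num.sqrt; apply: eq_bigr => i _ /=; rewrite !mxE.
by rewrite -real_normK ?num_real // -mod2piN opprB real_normK ?num_real.
Qed.

Lemma torus_dist_eq0 s t : torus_dist s t = 0 -> s = t.
Proof.
move=> /eqP; rewrite sqrtr_eq0 => h; apply/val_inj/rowP => i.
have h0 : \sum_(i < kappa)
    val (torus_proj (val s - val t)) ord0 i ^+ 2 == 0.
  by rewrite eq_le h sumr_ge0 // => j _; rewrite sqr_ge0.
move: h0; rewrite psumr_eq0 => [/allP/(_ i)|j _]; last by rewrite sqr_ge0.
rewrite mem_index_enum sqrf_eq0 !mxE => /(_ isT)/eqP.
have /forallP/(_ i)/andP[] := valP s; have /forallP/(_ i)/andP[] := valP t.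
set a := val s ord0 i; set b := val t ord0 i => b1 b2 a1 a2.
rewrite /mod2pi; set n := Num.floor _ => e.
have pp : 0 < pi :> R := pi_gt0 R.
have [n0|n0] := eqVneq n 0.
  by move: e; rewrite n0 mulr0 subr0 => /eqP; rewrite subr_eq0 => /eqP.
have H : 1 <= `|n%:~R| :> R.
  by rewrite -intr_norm -[1]/(1%:~R) ler_int -gtz0_ge1 normr_gt0.
have ab : a - b = 2 * pi * n%:~R by apply/eqP; rewrite -subr_eq0 e.
have : `|a - b| < 2 * pi by rewrite ltr_norml; apply/andP; split; lra.
rewrite ab normrM ger0_norm; last by rewrite mulr_ge0 // ltW.
by rewrite -[ltRHS]mulr1 ltr_pM2l ?mulr_gt0 // ltNge H.
Qed.

Lemma torus_dist_triangle t s r :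
  torus_dist s r <= torus_dist s t + torus_dist t r.
Proof.
apply: sqrt_triangle => [||l l0];
  [by apply: sumr_ge0 => i _; exact: sqr_ge0..|].
rewrite !mulr_sumr -big_split /=; apply: ler_sum => i _; rewrite !mxE.
set a := val s ord0 i; set b := val t ord0 i; set c := val r ord0 i.
rewrite -(real_normK (num_real (mod2pi (a - c)))).
rewrite -(real_normK (num_real (mod2pi (a - b)))).
rewrite -(real_normK (num_real (mod2pi (b - c)))).
apply: le_trans (sqrD_le _ _ l0); rewrite ler_sqr ?nnegrE ?addr_ge0 //.
by apply: le_trans (mod2piD _ _); rewrite addrA subrK.
Qed.

HB.instance Definition _ := isMetric.Build R torus
  torus_distxx torus_dist_eq0 torus_dist_sym torus_dist_triangle.

(* E x T^kappa with the Hilbert-type product metric, hence not the library's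
   product instance, whose distance is the maximum of the two. *)
Definition extended_space : Type := (E3 R * torus)%type.

HB.instance Definition _ := Choice.copy extended_space (E3 R * torus)%type.

Definition extended_dist (p q : extended_space) : R :=
  Num.sqrt (`|p.1 - q.1| ^+ 2 + torus_dist p.2 q.2 ^+ 2).

Lemma extended_distxx p : extended_dist p p = 0.
Proof.
by rewrite /extended_dist subrr normr0 torus_distxx expr0n addr0 sqrtr0.
Qed.

Lemma extended_dist_eq0 p q : extended_dist p q = 0 -> p = q.
Proof.
move=> /eqP; rewrite sqrtr_eq0 => h.
have h1 := sqr_ge0 `|p.1 - q.1|; have h2 := sqr_ge0 (torus_dist p.2 q.2).
have /eqP : `|p.1 - q.1| ^+ 2 = 0 by lra.
have /eqP : torus_dist p.2 q.2 ^+ 2 = 0 by lra.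
rewrite !sqrf_eq0 normr_eq0 subr_eq0 => /eqP/torus_dist_eq0 e2 /eqP e1.
by case: p q e1 e2 {h h1 h2} => [? ?] [? ?] /= -> ->.
Qed.

Lemma extended_dist_sym p q : extended_dist p q = extended_dist q p.
Proof. by rewrite /extended_dist distrC torus_dist_sym. Qed.

Lemma extended_dist_triangle q p r :
  extended_dist p r <= extended_dist p q + extended_dist q r.
Proof.
apply: sqrt_sqrD; rewrite ?normr_ge0 ?sqrtr_ge0 ?ler_distD //.
exact: torus_dist_triangle.
Qed.

HB.instance Definition _ := isMetric.Build R extended_space
  extended_distxx extended_dist_eq0 extended_dist_sym extended_dist_triangle.

End torus.

Section semidistance.
Variable R : realType.

Definition point_dist (T : Type) (d : T -> T -> R) (x : T) (Y : set T)
    : \bar R :=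
  ereal_inf [set (d x y)%:E | y in Y].

(* The supremum is taken in [0, +oo], so that it is 0 when X is empty. *)
Definition semidist (T : Type) (d : T -> T -> R) (X Y : set T) : \bar R :=
  maxe 0%E (ereal_sup [set point_dist d x Y | x in X]).

Definition metric_neighborhood (T : metricType R) (eps : R) (S : set T)
    : set T :=
  [set x | (point_dist mdist x S < eps%:E)%E].

Definition metric_bounded (T : metricType R) (B : set T) : Prop :=
  exists M : R, forall x y, B x -> B y -> mdist x y <= M.

Definition E3_dist (p q : E3 R) : R := `|p - q|.

End semidistance.

Section dynamics.
Variables (R : realType) (kappa : nat).
Local Notation T := (torus R kappa).
Local Notation E := (E3 R).

Definition sigma_section (S : set (extended_space R kappa)) (s : T) : set E :=
  [set p | S (p, s)].

Definition bundle (A : T -> set E) : set (extended_space R kappa) :=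
  [set q | A q.2 q.1].

Definition rationally_independent (x : 'rV[R]_kappa) : Prop :=
  forall q : 'I_kappa -> rat,
    \sum_(i < kappa) ratr (q i) * x ord0 i = 0 -> forall i, q i = 0.

Record gray_scott := GrayScott {
  gs_d1 : R; gs_d2 : R; gs_d3 : R;
  gs_k : R; gs_alpha : R; gs_beta : R; gs_lambda : R;
  gs_freq : 'rV[R]_kappa;
  gs_a : int -> R;
  gs_b1 : int -> R; gs_b2 : int -> R; gs_b3 : int -> R;
  gs_f1 : int -> T -> R; gs_f2 : int -> T -> R; gs_f3 : int -> T -> R
}.

Definition positive_constants (G : gray_scott) : Prop :=
  [/\ [/\ 0 < gs_d1 G, 0 < gs_d2 G & 0 < gs_d3 G],
      0 < gs_k G, 0 < gs_alpha G, 0 < gs_beta G & 0 < gs_lambda G].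

Definition H1 (G : gray_scott) : Prop :=
  [/\ gs_a G \in @l2_pred R, gs_b1 G \in @l2_pred R, gs_b2 G \in @l2_pred R,
      gs_b3 G \in @l2_pred R &
      let mu := gs_k G / gs_beta G in
      2 * gs_beta G < gs_k G <
        Num.min (3 * gs_lambda G / (2 * mu - 1)) (gs_beta G + gs_lambda G)].

Definition uniformly_lipschitz0 (f : int -> T -> R) : Prop :=
  (forall m, f m (torus_proj 0) = 0) /\
  exists2 c : R, 0 < c &
    forall m s1 s2, `|f m s1 - f m s2| <= c * torus_dist s1 s2.

Definition H2 (G : gray_scott) : Prop :=
  [/\ uniformly_lipschitz0 (gs_f1 G), uniformly_lipschitz0 (gs_f2 G)
    & uniformly_lipschitz0 (gs_f3 G)].

Definition theta (G : gray_scott) (t : R) (s : T) : T :=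
  torus_proj (t *: gs_freq G + val s).

Definition opA (u : int -> R) (m : int) : R :=
  2 * u m - u (m + 1) - u (m - 1).

(* The derivative is taken in the norm of E; being an equality between elements
   of E, the equation is then stated coordinate by coordinate. *)
Definition gs_equation (G : gray_scott) (s : T) (phi : R -> E) (t : R) : Prop :=
  let u := ucomp (phi t) in let v := vcomp (phi t) in let z := zcomp (phi t) in
  let st := theta G t s in
  derivable phi t 1 /\ forall m : int,
  [/\ ucomp ('D_1 phi t) m =
        - gs_d1 G * opA u m - (gs_lambda G + gs_k G) * u m + u m ^+ 2 * v m
        - gs_alpha G * u m ^+ 3 + gs_beta G * z m + gs_b1 G m * gs_f1 G m st,
      vcomp ('D_1 phi t) m =
        - gs_d2 G * opA v m - gs_lambda G * v m - u m ^+ 2 * v m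
        + gs_alpha G * u m ^+ 3 + gs_lambda G * gs_a G m
        + gs_b2 G m * gs_f2 G m st
    & zcomp ('D_1 phi t) m =
        - gs_d3 G * opA z m + gs_k G * u m - (gs_lambda G + gs_beta G) * z m
        + gs_b3 G m * gs_f3 G m st].

Definition gs_solution (G : gray_scott) (t0 : R) (phi0 : E) (s : T)
    (phi : R -> E) : Prop :=
  [/\ phi t0 = phi0, {within `[t0, +oo[, continuous phi}
    & forall t, t0 < t -> gs_equation G s phi t].

(* [U s t p] stands for U_s(t, 0) p; only its values at t >= 0 matter. *)
Definition generated_process (G : gray_scott) (U : T -> R -> E -> E) : Prop :=
  forall s p, gs_solution G 0 p s (fun t => U s t p).

Definition skew_product (G : gray_scott) (U : T -> R -> E -> E) (t : R)
    (q : extended_space R kappa) : extended_space R kappa :=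
  (U q.2 t q.1, theta G t q.2).

Definition global_attractor
    (Psi : R -> extended_space R kappa -> extended_space R kappa)
    (S : set (extended_space R kappa)) : Prop :=
  [/\ compact S, (forall t, 0 <= t -> Psi t @` S = S)
    & forall B, metric_bounded B ->
        semidist mdist (Psi t @` B) S @[t --> +oo%R] --> 0%E].

(* The pullback attractor is the family of sigma-sections of the global
   attractor of the skew-product flow. *)
Definition pullback_attractor (G : gray_scott) (U : T -> R -> E -> E)
    (A : T -> set E) : Prop :=
  global_attractor (skew_product G U) (bundle A).

Definition forward_invariant (G : gray_scott) (U : T -> R -> E -> E)
    (C : T -> set E) : Prop :=
  forall t s, 0 <= t -> U s t @` C s `<=` C (theta G t s).

Definition uniformly_forward_attracts (G : gray_scott) (U : T -> R -> E -> E)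
    (C : T -> set E) (B : set E) : Prop :=
  ereal_sup [set semidist (@E3_dist R) (U s t @` B) (C (theta G t s))
            | s in [set: T]]
    @[t --> +oo%R] --> 0%E.

End dynamics.

(* Main.v *)
(** Take for [Aeps] the points of the [eps]-neighborhood of the global attractor
    whose whole forward orbit under the skew-product flow stays in that
    neighborhood. By the semigroup law this family is forward invariant; it
    contains the attractor because the latter is invariant, and it absorbs every
    bounded set after a finite time, uniformly in the symbol, because the global
    attractor attracts [B x T^kappa]. The only analytic ingredient is the
    semigroup law, i.e. uniqueness of solutions of the lattice system, which
    needs only bounds that are uniform in the lattice index: on bounded
    sets the vector field is Lipschitz for the sup norm over all coordinates. *)
Require Import Defs.
From mathcomp Require Import all_boot all_order all_algebra.
From mathcomp Require Import all_classical all_reals all_analysis.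
From mathcomp Require Import ring lra.

Set Implicit Arguments.
Unset Strict Implicit.
Unset Printing Implicit Defensive.

Import Order.TTheory GRing.Theory Num.Theory.
Import numFieldNormedType.Exports.

Local Open Scope classical_set_scope.
Local Open Scope ring_scope.

(** * Gronwall estimate, uniform over an index family *)

(* In the norm [sup exp (- 2 K t) |x i t|] over all [i] and [t], integrating
   [|x'| <= K |x|] gains a factor [1 / 2]. *)
Lemma gronwall_halving (R : realType) (I : Type) (x dx : I -> R -> R)
    (T K c : R) : 0 < K -> 0 <= c ->
  (forall i, x i 0 = 0) ->
  (forall i, {within `[0, T], continuous (x i)}) ->
  (forall i (t : R), t \in `]0, T[ -> is_derive t 1 (x i) (dx i t)) ->
  (forall (t b : R), t \in `]0, T[ -> (forall i, `|x i t| <= b) ->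
     forall i, `|dx i t| <= K * b) ->
  (forall i (t : R), t \in `[0, T] -> `|x i t| <= c * expR (2 * K * t)) ->
  forall i (t : R), t \in `[0, T] -> `|x i t| <= c / 2 * expR (2 * K * t).
Proof.
move=> K0 c0 x0 xc xd dxle xle i t tT.
have exp_cont : continuous (fun t : R => c / 2 * expR (2 * K * t) : R).
  by move=> y; apply: differentiable_continuous; apply/derivable1_diffP.
(* The sign [s] is 1 or -1, which gives both halves of the absolute value at once. The function [g]
   starts at [c / 2] and is nondecreasing, because [|s * dx i y|] is at most
   [c * K * expR (2 * K * y)]. *)
have main (s : R) : s ^+ 2 = 1 -> 0 <= c / 2 * expR (2 * K * t) + s * x i t.
  move=> s1; pose g (y : R) : R := c / 2 * expR (2 * K * y) + s * x i y.
  have gd (y : R) : y \in `]0, T[ ->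
      is_derive y 1 g (c * K * expR (2 * K * y) + s * dx i y).
    move=> yT; have := xd i y yT => ?.
    rewrite /g; apply: is_derive_eq; rewrite /GRing.scale /=; by field.
  have g0 : 0 <= g 0 by rewrite /g x0 !mulr0 expR0 addr0 mulr1; lra.
  apply: le_trans g0 _.
  have tI := tT; move: tI; rewrite in_itv /= => /andP[t0 tT'].
  apply: (@ger0_derive1_le_cc _ g 0 T).
  - by move=> y /gd [].
  - move=> y yT; rewrite derive1E; have /@derive_val -> := gd y yT.
    have yT' : y \in `[0, T] by move: yT; apply: subset_itv_oo_cc.
    have := dxle y _ yT (fun i => xle i y yT') i.
    have : `|s * dx i y| = `|dx i y|.
      by rewrite normrM -sqrtr_sqr s1 sqrtr1 mul1r.
    move=> <-; rewrite ler_norml => /andP[h _]; lra.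
  - move=> y; apply: cvgD; first exact: continuous_subspaceT exp_cont _.
    by apply: cvgM; [exact: cvg_cst|exact: xc].
  - by rewrite in_itv /= lexx (le_trans t0).
  - exact: tT.
  - exact: t0.
have h1 := main 1; have h2 := main (-1).
rewrite ler_norml; apply/andP; split; first by have := h1 (expr1n _ _); lra.
have := h2; rewrite sqrrN expr1n => /(_ erefl); lra.
Qed.

(** Halving is iterated from the constant bound [M], and the factor [2^-1 ^+ n] tends to 0. Each
    index carries its own bound, so the supremum over infinitely many indices is never
    differentiated. *)
Lemma gronwall_sup (R : realType) (I : Type) (x dx : I -> R -> R)
    (T K M : R) : 0 < K ->
  (forall i, x i 0 = 0) ->
  (forall i, {within `[0, T], continuous (x i)}) ->
  (forall i (t : R), t \in `]0, T[ -> is_derive t 1 (x i) (dx i t)) ->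
  (forall (t b : R), t \in `]0, T[ -> (forall i, `|x i t| <= b) ->
     forall i, `|dx i t| <= K * b) ->
  (forall i (t : R), t \in `[0, T] -> `|x i t| <= M) ->
  forall i (t : R), t \in `[0, T] -> x i t = 0.
Proof.
move=> K0 x0 xc xd dxle xM i t tT.
have M0 : 0 <= M by apply: le_trans (xM i t tT).
have it n : forall i (t : R), t \in `[0, T] ->
    `|x i t| <= M * 2^-1 ^+ n * expR (2 * K * t).
  elim: n => [|n IH] {}i {}t {}tT.
    apply: le_trans (xM i t tT) _; rewrite expr0 mulr1 ler_peMr //.
    rewrite -expR0 ler_expR.
    by move: tT; rewrite in_itv /= => /andP[t0 _]; rewrite !mulr_ge0 // ltW.
  rewrite exprSr mulrA.
  by apply: gronwall_halving IH _ _ tT => //; rewrite mulr_ge0 // exprn_ge0.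
apply/eqP; rewrite -normr_le0.
have lim : (M * 2^-1 ^+ n * expR (2 * K * t) @[n --> \oo] --> 0).
  rewrite -(mul0r (expR (2 * K * t))) -(mulr0 M).
  apply: cvgM; last exact: cvg_cst.
  apply: cvgM; first exact: cvg_cst.
  by apply: cvg_expr; rewrite ger0_norm //; lra.
apply: ler_cvg_to (cvg_cst _) lim _; exact: nearW (fun n => it n i t tT).
Qed.

(** * Scalar coordinates of the state space *)

Variant species := Activator | Substrate | Product.

Section coordinates.
Variable R : realType.
Implicit Types (p q : E3 R) (i : species * int).

(** One index for all scalar unknowns turns the lattice system into a single family to which
    [gronwall_sup] applies. *)
Definition coord i p : R :=
  match i.1 with
  | Activator => ucomp p
  | Substrate => vcomp p
  | Product => zcomp p
  end i.2.

Lemma l2_coord_le (u : l2 R) m : `|u m| <= `|u|.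
Proof.
rewrite -sqrtr_sqr ler_wsqrtr // -lee_fin fineK ?l2_fin_num //.
by apply: esum_ge; exists [set m]; [split|rewrite fsbig_set1].
Qed.

Lemma coordB i p q : coord i (p - q) = coord i p - coord i q.
Proof. by case: i => [[]]. Qed.

Lemma coordZ i c p : coord i (c *: p) = c * coord i p.
Proof. by case: i => [[]]. Qed.

Lemma coord_le i p : `|coord i p| <= `|p|.
Proof.
have sq0 (u : l2 R) : 0 <= `|u| ^+ 2 by exact: sqr_ge0.
have h (u : l2 R) : `|u| ^+ 2 <= `|ucomp p| ^+ 2 + `|vcomp p| ^+ 2
    + `|zcomp p| ^+ 2 -> forall m, `|u m| <= `|p|.
  move=> le m; apply: le_trans (l2_coord_le u m) _.
  by rewrite -[leLHS]normr_id -sqrtr_sqr; exact: ler_wsqrtr.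
have := sq0 (ucomp p); have := sq0 (vcomp p); have := sq0 (zcomp p).
by case: i => [[] m] *; apply: h; lra.
Qed.

Lemma coord_ext p q : (forall i, coord i p = coord i q) -> p = q.
Proof.
move=> e; apply: E3_ext; apply/val_inj/funext => m.
- exact: (e (Activator, m)).
- exact: (e (Substrate, m)).
- exact: (e (Product, m)).
Qed.

Lemma coord_continuous i : continuous (coord i).
Proof.
move=> p; apply/(@cvgrPdist_le _ _ _ _ (nbhs_filter p)) => e e0.
have near_p := @cvgr_dist_le _ _ _ _ (nbhs_filter p) id p cvg_id e e0.
apply: filterS near_p => q; rewrite -coordB; exact: le_trans (coord_le _ _).
Qed.

(** A coordinate is linear and continuous, so it passes through the difference quotient and its
    limit. *)
Lemma coord_is_derive i (phi : R -> E3 R) (t : R) : derivable phi t 1 ->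
  is_derive t 1 (coord i \o phi) (coord i ('D_1 phi t)).
Proof.
move=> dphi.
have lim : h^-1 *: ((coord i \o phi \o shift t) (h *: 1) - coord i (phi t))
    @[h --> 0^'] --> coord i ('D_1 phi t).
  apply: cvg_trans _ (continuous_cvg _ (@coord_continuous i _) dphi).
  by apply: near_eq_cvg; apply: nearW => h /=; rewrite coordZ coordB.
by split; [apply/cvg_ex; exists (coord i ('D_1 phi t))|exact: cvg_lim].
Qed.

End coordinates.

(** * Lipschitz bound for the vector field on bounded sets *)

Section vector_field.
Variables (R : realType) (kappa : nat) (G : gray_scott R kappa).
Implicit Types (p q : E3 R) (i : species * int).

(** Kept as a family of reals rather than a point of [E3 R], so that its summability never has to be
    established. *)
Definition gs_field (s : torus R kappa) p i : R :=
  let u := ucomp p in let v := vcomp p in let z := zcomp p in let m := i.2 in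
  match i.1 with
  | Activator =>
      - gs_d1 G * opA u m - (gs_lambda G + gs_k G) * u m + u m ^+ 2 * v m
      - gs_alpha G * u m ^+ 3 + gs_beta G * z m + gs_b1 G m * gs_f1 G m s
  | Substrate =>
      - gs_d2 G * opA v m - gs_lambda G * v m - u m ^+ 2 * v m
      + gs_alpha G * u m ^+ 3 + gs_lambda G * gs_a G m
      + gs_b2 G m * gs_f2 G m s
  | Product =>
      - gs_d3 G * opA z m + gs_k G * u m - (gs_lambda G + gs_beta G) * z m
      + gs_b3 G m * gs_f3 G m s
  end.

Lemma gs_equation_coord s (phi : R -> E3 R) t : gs_equation G s phi t ->
  derivable phi t 1 /\
  forall i, coord i ('D_1 phi t) = gs_field (theta G t s) (phi t) i.
Proof. by case=> d e; split=> // -[[] m]; have [] := e m. Qed.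

Lemma opA_lipschitz (u v : int -> R) b : (forall m, `|u m - v m| <= b) ->
  forall m, `|opA u m - opA v m| <= 4 * b.
Proof.
move=> uv m; have := uv m; have := uv (m + 1); have := uv (m - 1).
rewrite /opA !ler_norml => /andP[? ?] /andP[? ?] /andP[? ?].
by apply/andP; split; lra.
Qed.

(** Telescoping changes [y] first and then [x], at costs [M ^+ 2 * b] and [2 * M ^+ 2 * b]. It
    serves both the reaction term and, with [y = x], the cubic term. *)
Lemma sqr_mul_lipschitz (x y x' y' M b : R) :
  `|x| <= M -> `|x'| <= M -> `|y'| <= M ->
  `|x - x'| <= b -> `|y - y'| <= b ->
  `|x ^+ 2 * y - x' ^+ 2 * y'| <= 3 * M ^+ 2 * b.
Proof.
move=> xM x'M y'M xb yb.
have -> : x ^+ 2 * y - x' ^+ 2 * y'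
    = x * x * (y - y') + (x - x') * (x + x') * y' by ring.
have -> : 3 * M ^+ 2 * b = M * M * b + b * (M + M) * M by ring.
apply: le_trans (ler_normD _ _) _; rewrite !normrM.
apply: lerD; first by rewrite !ler_pM // mulr_ge0.
rewrite !ler_pM ?mulr_ge0 // (le_trans (ler_normD _ _)) //.
by rewrite lerD.
Qed.

(** A single constant dominating all three equations: 4 bounds [opA] in the sup norm, and
    [3 * M ^+ 2] comes from [sqr_mul_lipschitz]. *)
Definition gs_lipschitz (M : R) : R :=
  1 + 4 * (gs_d1 G + gs_d2 G + gs_d3 G) + gs_k G + gs_lambda G + gs_beta G
  + 3 * M ^+ 2 + gs_alpha G * (3 * M ^+ 2).

Hypothesis Gpos : positive_constants G.

Lemma gs_lipschitz_gt0 M : 0 < gs_lipschitz M.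
Proof.
case: Gpos => -[d1 d2 d3] k a be la; have M2 := sqr_ge0 M.
have aM : 0 <= gs_alpha G * (3 * M ^+ 2) by rewrite mulr_ge0 ?(ltW a) // mulr_ge0.
by rewrite /gs_lipschitz; lra.
Qed.

Lemma gs_field_lipschitz s p q (M b : R) :
  (forall i, `|coord i p| <= M) -> (forall i, `|coord i q| <= M) ->
  (forall i, `|coord i p - coord i q| <= b) ->
  forall i, `|gs_field s p i - gs_field s q i| <= gs_lipschitz M * b.
Proof.
case: Gpos => -[d1 d2 d3] k a be la pM qM pqb [j m].
have b0 : 0 <= b by apply: le_trans (pqb (j, m)).
have scale (c x y : R) : 0 < c -> `|x| <= y -> - (c * y) <= c * x <= c * y.
  move=> c0 xy; rewrite -ler_norml normrM gtr0_norm // ler_pM2l //.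
have uM := pM (Activator, m); have vM := pM (Substrate, m).
have u'M := qM (Activator, m); have v'M := qM (Substrate, m).
have du n := pqb (Activator, n); have dv n := pqb (Substrate, n).
have dz n := pqb (Product, n).
rewrite /coord /= in uM vM u'M v'M du dv dz.
have := scale _ _ _ d1 (opA_lipschitz du m).
have := scale _ _ _ d2 (opA_lipschitz dv m).
have := scale _ _ _ d3 (opA_lipschitz dz m).
have := scale _ _ _ la (du m); have := scale _ _ _ k (du m).
have := scale _ _ _ la (dv m).
have := scale _ _ _ be (dz m); have := scale _ _ _ la (dz m).
have := sqr_mul_lipschitz uM u'M v'M (du m) (dv m); rewrite ler_norml.
have := scale _ _ _ a (sqr_mul_lipschitz uM u'M u'M (du m) (du m)).
(* Each equation uses only some summands of [gs_lipschitz M * b]; these signs let [lra] discard the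
   others. The forcing terms cancel, both fields having the same symbol. *)
have d1b : 0 <= gs_d1 G * b by rewrite mulr_ge0 // ltW.
have d2b : 0 <= gs_d2 G * b by rewrite mulr_ge0 // ltW.
have d3b : 0 <= gs_d3 G * b by rewrite mulr_ge0 // ltW.
have kb : 0 <= gs_k G * b by rewrite mulr_ge0 // ltW.
have lab : 0 <= gs_lambda G * b by rewrite mulr_ge0 // ltW.
have beb : 0 <= gs_beta G * b by rewrite mulr_ge0 // ltW.
have Mb : 0 <= M ^+ 2 * b by rewrite mulr_ge0 // sqr_ge0.
have aMb : 0 <= gs_alpha G * (M ^+ 2 * b) by rewrite mulr_ge0 // ltW.
move=> /andP[? ?] /andP[? ?] /andP[? ?] /andP[? ?] /andP[? ?] /andP[? ?].
move=> /andP[? ?] /andP[? ?] /andP[? ?] /andP[? ?].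
by case: j; rewrite /gs_field /gs_lipschitz /= ler_norml; apply/andP; split;
  lra.
Qed.

End vector_field.

(** * Uniqueness and time translation of solutions *)

Section solutions.
Variables (R : realType) (kappa : nat) (G : gray_scott R kappa).

Lemma bounded_set_norm (V : normedModType R) (B : set V) : bounded_set B ->
  exists M : R, forall x, B x -> `|x| <= M.
Proof.
case=> M [_ hM]; exists (M + 1) => x Bx.
by apply: (hM (M + 1)) => //; rewrite ltrDl.
Qed.

Lemma within_itv_bounded (V : normedModType R) (phi : R -> V) (t : R) :
  {within `[0, t], continuous phi} ->
  exists M : R, forall y, y \in `[0, t] -> `|phi y| <= M.
Proof.
move=> phic.
have := continuous_compact phic (@segment_compact R 0 t).
move=> /compact_bounded/bounded_set_norm[M hM]; exists M => y yt.
by apply: hM; exists y.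
Qed.

(** Both solutions are bounded on the compact interval [[0, t]], so the field is Lipschitz along
    them and [gronwall_sup] annihilates the coordinates of their difference. *)
Lemma gs_solution_unique s p (phi psi : R -> E3 R) : positive_constants G ->
  gs_solution G 0 p s phi -> gs_solution G 0 p s psi ->
  forall t, 0 <= t -> phi t = psi t.
Proof.
move=> Gpos [phi0 phic phie] [psi0 psic psie] t t0.
have sub : `[0, t] `<=` `[0, +oo[.
  by move=> y; rewrite /= !in_itv /= andbT => /andP[].
have {}phic := continuous_subspaceW sub phic.
have {}psic := continuous_subspaceW sub psic.
have [M1 phiM] := within_itv_bounded phic.
have [M2 psiM] := within_itv_bounded psic.
pose M := Num.max M1 M2.
have phiM' i y : y \in `[0, t] -> `|coord i (phi y)| <= M.
  by move=> /phiM h; rewrite le_max (le_trans (coord_le _ _)).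
have psiM' i y : y \in `[0, t] -> `|coord i (psi y)| <= M.
  by move=> /psiM h; rewrite le_max orbC (le_trans (coord_le _ _)).
have coordc i (f : R -> E3 R) : {within `[0, t], continuous f} ->
    {within `[0, t], continuous (coord i \o f)}.
  move=> fc y; apply: (continuous_comp (fc y)); exact: coord_continuous.
have oo_cc (y : R) : y \in `]0, t[ -> y \in `[0, t].
  by apply: subset_itv_oo_cc.
apply: coord_ext => i; apply/eqP; rewrite -subr_eq0; apply/eqP.
apply: (@gronwall_sup R _
  (fun j y => coord j (phi y) - coord j (psi y))
  (fun j y => gs_field G (theta G y s) (phi y) j
              - gs_field G (theta G y s) (psi y) j)
  t (gs_lipschitz G M) (M + M)).
- exact: gs_lipschitz_gt0.
- by move=> j; rewrite phi0 psi0 subrr.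
- move=> j y.
  by apply: cvgB; [exact: (coordc j _ phic)|exact: (coordc j _ psic)].
- move=> j y; rewrite in_itv /= => /andP[y0 _].
  have [dphi <-] := gs_equation_coord (phie y y0).
  have [dpsi <-] := gs_equation_coord (psie y y0).
  have ? := coord_is_derive j dphi; have ? := coord_is_derive j dpsi.
  exact: is_deriveB.
- move=> y b yt hb; apply: gs_field_lipschitz => // j.
  + by apply: phiM'; exact: oo_cc.
  + by apply: psiM'; exact: oo_cc.
- move=> j y yt; apply: le_trans (ler_normB _ _) _.
  by rewrite lerD ?phiM' ?psiM'.
- by rewrite in_itv /= t0 lexx.
Qed.

Lemma mod2piDz (x : R) (n : int) : mod2pi (x + 2 * pi * n%:~R) = mod2pi x.
Proof.
rewrite /mod2pi; move: (pi_gt0 R); move: (pi : R) => c c0.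
have -> : (x + 2 * c * n%:~R + c) / (2 * c) = (x + c) / (2 * c) + n%:~R.
  by field; rewrite gt_eqF.
rewrite floorDrz ?intr_int // intrKfloor intrD; ring.
Qed.

Lemma mod2pi_modr (x y : R) : mod2pi (x + mod2pi y) = mod2pi (x + y).
Proof. by have [n ->] := mod2piE y; rewrite addrA mod2piDz. Qed.

Lemma thetaD t1 t2 s : theta G t2 (theta G t1 s) = theta G (t1 + t2) s.
Proof.
apply/val_inj/rowP => i; rewrite /= !mxE mod2pi_modr.
by congr mod2pi; ring.
Qed.

(** The two representatives agree modulo 2 pi, so their distance is 0; [torus_dist_eq0] holds the
    uniqueness of the representative. *)
Lemma theta0 s : theta G 0 s = s.
Proof.
apply: torus_dist_eq0; rewrite -[RHS](torus_distxx s) /torus_dist.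
congr torus_norm; apply/val_inj/rowP => i.
by rewrite /= !mxE mul0r add0r ![_ - sval s _ _]addrC mod2pi_modr.
Qed.

Lemma gs_solution_shift s p (phi : R -> E3 R) t : 0 <= t ->
  gs_solution G 0 p s phi ->
  gs_solution G 0 (phi t) (theta G t s) (fun y => phi (t + y)).
Proof.
move=> t0 [phi0 phic phie]; split; first by rewrite addr0.
(* At [t = 0] the left endpoint has only one-sided continuity, and the claim is the hypothesis
   itself. For [t > 0] the shifted endpoint is an interior point of the original interval. *)
- have [->|tn0] := eqVneq t 0.
    by under [X in continuous X]eq_fun do rewrite add0r.
  have {tn0}t0 : 0 < t by rewrite lt_neqAle eq_sym tn0.
  move/continuous_within_itvcyP : phic => [phic _].
  have shiftc y : 0 <= y -> {for y, continuous (fun y => phi (t + y))}.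
    move=> y0; apply: (@continuous_comp _ _ _ (fun y => t + y) phi).
      by apply: cvgD; [exact: cvg_cst|exact: cvg_id].
    by apply: phic; rewrite in_itv /= andbT ltr_wpDr.
  apply/continuous_within_itvcyP; split.
    by move=> y; rewrite in_itv /= andbT => /ltW; exact: shiftc.
  apply: cvg_at_right_filter; exact: shiftc.
- move=> y y0; have := phie (t + y) (ltr_wpDl t0 y0).
  have shiftE (h : R) : t + (h *: 1 + y) = h *: 1 + (t + y) by rewrite addrCA.
  rewrite /gs_equation /derivable /derive /= thetaD.
  by under [in X in _ -> X]eq_fun do rewrite shiftE.
Qed.

End solutions.

(** * Semigroup law of the skew product *)

Section processes.
Variables (R : realType) (kappa : nat) (G : gray_scott R kappa).
Variable U : torus R kappa -> R -> E3 R -> E3 R.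
Hypothesis Gpos : positive_constants G.
Hypothesis UG : generated_process G U.

(** As functions of [t2], both sides solve the system with symbol [theta G t1 s] from the same
    initial state. *)
Lemma process_cocycle s p t1 t2 : 0 <= t1 -> 0 <= t2 ->
  U (theta G t1 s) t2 (U s t1 p) = U s (t1 + t2) p.
Proof.
move=> t10 t20.
exact: gs_solution_unique Gpos (UG _ _) (gs_solution_shift t10 (UG s p)) _ t20.
Qed.

Lemma skew_productD t1 t2 q : 0 <= t1 -> 0 <= t2 ->
  skew_product G U t2 (skew_product G U t1 q) = skew_product G U (t1 + t2) q.
Proof. by move=> ? ?; rewrite /skew_product /= process_cocycle // thetaD. Qed.

Lemma skew_product0 q : skew_product G U 0 q = q.
Proof. by case: q => p s; rewrite /skew_product theta0 /=; have [->] := UG s p. Qed.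

End processes.

(** * Neighborhoods, semidistances and bounded sets *)

Lemma point_dist_lt (R : realType) (T : Type) (d : T -> T -> R) x Y (e : R) :
  (point_dist d x Y < e%:E)%E <-> exists2 y, Y y & d x y < e.
Proof.
split=> [/ereal_inf_lt[_ [y Yy <-]] h|[y Yy h]]; first by exists y.
by apply/ereal_inf_ltP; exists (d x y)%:E => //; exists y.
Qed.

Lemma sub_metric_neighborhood (R : realType) (T : metricType R)
    (S : set T) (e : R) : 0 < e -> S `<=` metric_neighborhood e S.
Proof. by move=> e0 x Sx; apply/point_dist_lt; exists x; rewrite ?mdistxx. Qed.

Lemma semidist_lt_sub (R : realType) (T : metricType R) (X S : set T) (e : R) :
  (semidist mdist X S < e%:E)%E -> X `<=` metric_neighborhood e S.
Proof.
rewrite /semidist gt_max => /andP[_ h] x Xx; apply: le_lt_trans h.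
by apply: ereal_sup_ubound; exists x.
Qed.

Lemma semidist_eq0 (R : realType) (X Y : set (E3 R)) :
  X `<=` Y -> semidist (@E3_dist R) X Y = 0%E.
Proof.
move=> XY; apply/max_idPl/ge_ereal_sup => _ [x Xx <-].
apply: ereal_inf_lbound; exists x; first exact: XY.
by rewrite /E3_dist subrr normr0.
Qed.

(** Torus distances are bounded, each coordinate of a difference being at most pi in absolute value.
    Attraction of this product set is what yields uniformity in the symbol. *)
Lemma extended_bounded (R : realType) (kappa : nat) (B : set (E3 R)) :
  bounded_set B ->
  metric_bounded ([set q | B q.1] : set (extended_space R kappa)).
Proof.
move=> /bounded_set_norm[M hM].
exists (Num.sqrt ((M + M) ^+ 2 + \sum_(i < kappa) pi ^+ 2)) => x y Bx By.
apply: ler_wsqrtr; apply: lerD.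
  have xy : `|x.1 - y.1| <= M + M.
    by rewrite (le_trans (ler_normB _ _)) // lerD ?hM.
  by rewrite ler_sqr ?nnegrE // (le_trans _ xy).
rewrite sqr_sqrtr; last by apply: sumr_ge0 => i _; exact: sqr_ge0.
apply: ler_sum => i _; rewrite mxE.
have /andP[h1 h2] := mod2pi_itv ((val x.2 - val y.2) ord0 i).
by rewrite -real_normK ?num_real // ler_sqr ?nnegrE ?pi_ge0 // ler_norml h1 ltW.
Qed.

Theorem theorem4p4 (R : realType) (kappa : nat) (G : gray_scott R kappa)
    (U : torus R kappa -> R -> E3 R -> E3 R) (A : torus R kappa -> set (E3 R)) :
  (0 < kappa)%N ->
  positive_constants G ->
  rationally_independent (gs_freq G) ->
  H1 G ->
  H2 G ->
  generated_process G U ->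
  pullback_attractor G U A ->
  forall eps : R, 0 < eps ->
  exists Aeps : torus R kappa -> set (E3 R),
    [/\ forall s, A s `<=` Aeps s /\
          Aeps s `<=` sigma_section (metric_neighborhood eps (bundle A)) s,
        forward_invariant G U Aeps
      & forall B : set (E3 R), bounded_set B ->
          uniformly_forward_attracts G U Aeps B].
Proof.
move=> _ Gpos _ _ _ UG [_ Sinv Sattr] eps eps0.
pose N := metric_neighborhood eps (bundle A).
exists (fun s => [set p | forall t, 0 <= t -> N (skew_product G U t (p, s))]).
split.
- move=> s; split=> p /=.
    move=> Ap t t0; apply: sub_metric_neighborhood => //.
    by rewrite -(Sinv t t0); exists (p, s).
  by move=> /(_ 0 (lexx _)); rewrite skew_product0.
- move=> t s t0 _ [p Np <-] t' t'0.
  rewrite -[(_, _)]/(skew_product G U t (p, s)) skew_productD //.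
  by apply: Np; rewrite addr_ge0.
- move=> B bB.
  pose BT : set (extended_space R kappa) := [set q | B q.1].
  have lt_eps : nbhs (0 : \bar R)%E [set x | (x < eps%:E)%E].
    by apply: open_nbhs_nbhs; split; [exact: open_ereal_lt_ereal|rewrite /= lte_fin].
  have [T [_ hT]] := Sattr BT (extended_bounded _ bB) _ lt_eps.
  (* After absorption the semidistance is exactly 0, so the function is eventually constant. *)
  apply: cvg_near_cst.
  exists (Num.max 0 T); split; first exact: num_real.
  move=> t; rewrite gt_max => /andP[t0 Tt].
  have semidist0 s : semidist (@E3_dist R) (U s t @` B)
      [set p | forall t', 0 <= t' ->
                 N (skew_product G U t' (p, theta G t s))] = 0%E.
    apply: semidist_eq0 => _ [p Bp <-] t' t'0.
    rewrite -[(_, _)]/(skew_product G U t (p, s)) skew_productD // ?ltW //.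
    (* The time [T] precedes the choice of [t'], so every later time [t + t'] also exceeds it and
       the whole forward orbit stays in [N]. *)
    apply: (semidist_lt_sub (hT (t + t') _)); first by rewrite ltr_wpDr.
    by exists (p, s).
  (* The torus must be seen to have a point: over an empty set of symbols the supremum would be
     [-oo], not 0. *)
  rewrite (_ : [set _ | _ in _] = [set 0%E]) ?ereal_sup1 //.
  apply/seteqP; split=> [_ [s _ <-]|_ ->]; first exact: semidist0.
  by exists (torus_proj 0).
Qed.
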